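(* Let $\mathbb{F}_q$ be a finite field, let $f \in \mathbb{F}_q[x]$ with $d = \deg(f) > 0$ be a polynomial such that $\gcd(d,q)=1$, and let $a,b \in \mathbb{F}_q^\times$. Then ${}_1\mathcal{B}_f(a,b) \leq d\cdot(d-2)$.
   Context: $\mathbb{F}_q$ is the finite field with $q$ elements, $\mathbb{F}_q^\times=\mathbb{F}_q\setminus\{0\}$. For $c\in\mathbb{F}_q^\times$, a function $F:\mathbb{F}_q\to\mathbb{F}_q$ and $a,b\in\mathbb{F}_q$, the entry of the $c$-Boomerang Connectivity Table of $F$ at $(a,b)$ is $${}_c\mathcal{B}_F(a,b)=\left|\{(x,y)\in\mathbb{F}_q^2 \mid F(x+y)-c\cdot F(x)=b,\ \ c\cdot F(x+y+a)-F(x+a)=c\cdot b\}\right|.$$ A polynomial $f\in\mathbb{F}_q[x]$ is identified with the function it induces on $\mathbb{F}_q$.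
   Formalization: The case d = 1 is excluded: for f of degree 1 both equations reduce to the same condition on y, so the table entry equals q for all nonzero a, b, while d(d-2) = -1; the claim is proved for all d ≥ 2. *)

(* Defs.v *)
From mathcomp Require Import all_boot all_order all_algebra.

Set Implicit Arguments.
Unset Strict Implicit.
Unset Printing Implicit Defensive.

Import GRing.Theory.
Local Open Scope ring_scope.

Definition cBCT (K : finFieldType) (c : K) (F : K -> K) (a b : K) : nat :=
  #|[set xy : K * K |
      (F (xy.1 + xy.2) - c * F xy.1 == b) &&
      (c * F (xy.1 + xy.2 + a) - F (xy.1 + a) == c * b)]|.

(* Main.v *)
Require Import Defs.
From mathcomp Require Import all_boot all_order all_algebra.
From mathcomp Require Import finalg fingroup perm cyclic ring.

(** With [u = x + y] the table counts the points [(x, u)] such that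
    [f(u) - f(x) = b] and [f(u + a) - f(x + a) = b].  Put [g(x) = f(x + a) - f(x)]:
    the second equation becomes [g(u) = g(x)].  Since the characteristic does not
    divide [d], [g] has degree [d - 1]; since [b] is nonzero, [u] differs from [x],
    and one may divide [g(u) - g(x)] by [u - x].  So the points are common zeros of
    two curves of degrees [d] and [d - 2], and Bezout's theorem gives [d * (d - 2)]
    as soon as the curves have no common component ([coprime_curves]).

    Bezout's theorem ([bezout]) is proved for a second curve [Q] monic in [u].
    The first curve [P] acts by multiplication on the free [F[x]]-module
    [F[x][u] / (Q)]; its determinant has degree at most the product of the degrees
    ([size_det_leq], [tdeg_rmodp]), is nonzero when there is no common component,
    and vanishes at [x] to an order at least the number of common zeros above [x]
    ([dvdp_det_corank], [rank_Vandermonde]).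

    For the common component, put [u = t x].  The forms of highest degree become
    [t ^ d - 1] and [(t ^ (d - 1) - 1) / (t - 1)] up to constants, and their gcd
    divides [t - 1] ([top_form_obstruction]).  It equals [t - 1] when the
    characteristic divides [d - 1], so the top forms alone do not exclude a
    component; they show that it is a graph [u = r(x)] ([cofactor_size_geq],
    [common_poly_root]).  Then [f(r(x)) = f(x) + b] and [g(r(x)) = g(x)], which is
    impossible ([no_common_poly_root]). *)

Set Implicit Arguments.
Unset Strict Implicit.
Unset Printing Implicit Defensive.

Import GRing.Theory.
Local Open Scope ring_scope.

(** * Vanishing order and degree of determinants *)

(** The powers [('X - x%:P) ^+ k x] at distinct [x] are pairwise coprime, so
    their product divides [p]. *)
Lemma sum_root_order_leq (F : fieldType) (p : {poly F}) (s : seq F)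
    (k : F -> nat) :
  p != 0 -> uniq s -> (forall x, x \in s -> ('X - x%:P) ^+ k x %| p) ->
  (\sum_(x <- s) k x <= (size p).-1)%N.
Proof.
move=> p0 Us dvd_p.
suff dvd_prod: \prod_(x <- s) ('X - x%:P) ^+ k x %| p.
  rewrite -ltnS prednK ?size_poly_gt0 //; apply: leq_trans (dvdp_leq p0 dvd_prod).
  elim: {Us dvd_p dvd_prod} s => [|x s IHs]; first by rewrite !big_nil size_poly1.
  rewrite !big_cons size_monicM ?monic_exp ?monicXsubC //; last first.
    by apply/monic_neq0/monic_prod => y _; rewrite monic_exp ?monicXsubC.
  by rewrite size_exp_XsubC addSn /= -addnS leq_add2l.
elim: s Us dvd_p => [|x s IHs]; first by rewrite big_nil dvd1p.
rewrite cons_uniq big_cons => /andP[xs Us] dvd_p.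
rewrite Gauss_dvdp; last first.
  rewrite big_seq; elim/big_rec: _ => [|y q ys cop]; first exact: coprimep1.
  rewrite coprimepMr cop andbT coprimep_expl // coprimep_expr //.
  by rewrite coprimep_XsubC2 // subr_eq0; apply: contraNneq xs => <-.
rewrite dvd_p ?mem_head // IHs // => y ys; apply: dvd_p.
by rewrite in_cons ys orbT.
Qed.

(** By Gaussian elimination on the value of [M] at [x], constant invertible row
    operations on [M] make all rows beyond the rank vanish at [x]; each of these
    rows contributes a factor ['X - x%:P] to the determinant. *)
Lemma dvdp_det_corank (F : fieldType) (n : nat) (M : 'M[{poly F}]_n) (x : F) :
  ('X - x%:P) ^+ (n - \rank (map_mx (horner_eval x) M)) %| \det M.
Proof.
set A := map_mx _ M; set r := \rank A.
pose L : 'M[{poly F}]_n := map_mx polyC (invmx (col_ebase A)).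
pose N := L *m M.
have NE : map_mx (horner_eval x) N = pid_mx r *m row_ebase A.
  rewrite map_mxM -/A -{1}[A]mulmx_ebase.
  have -> : map_mx (horner_eval x) L = invmx (col_ebase A).
    by apply/matrixP=> i j; rewrite !mxE /horner_eval hornerC.
  by rewrite -mulmxA mulKmx ?col_ebase_unit.
(* The factors to be taken out of the rows of [N]. *)
pose D : 'rV[{poly F}]_n := \row_i (if (i < r)%N then 1 else 'X - x%:P).
have dvdN i j : D 0 i %| N i j.
  rewrite mxE; case: ifPn => [_|]; first exact: dvd1p.
  rewrite -leqNgt => ri; rewrite dvdp_XsubCl rootE.
  have := congr1 (fun B : 'M_n => B i j) NE; rewrite mxE /horner_eval => ->.
  rewrite mxE big1 // => l _; rewrite mxE ltnNge ri andbF mul0r //.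
have -> : ('X - x%:P) ^+ (n - r) = \det (diag_mx D).
  rewrite det_diag (bigID (fun i : 'I_n => (i < r)%N)) /= big1 ?mul1r => [|i ri].
    rewrite (eq_bigr (fun=> 'X - x%:P)) => [|i /negbTE ri]; last by rewrite mxE ri.
    rewrite prodr_const; congr (_ ^+ _).
    have /= := cardC (fun i : 'I_n => (i < r)%N); rewrite card_ord.
    rewrite -[X in (X + _)%N]sum1_card (big_ord_narrow (rank_leq_row A)).
    by rewrite sum1_card card_ord -/r => {1}<-; rewrite addKn.
  by rewrite mxE ri.
have -> : M = map_mx polyC (col_ebase A) *m N.
  by rewrite mulmxA -map_mxM /= mulmxV ?col_ebase_unit // map_mx1 mul1mx.
have -> : N = diag_mx D *m \matrix_(i, j) (N i j %/ D 0 i).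
  apply/matrixP => i j; rewrite mul_diag_mx mxE [X in _ * X]mxE mulrC.
  by rewrite divpK ?dvdN.
by rewrite !det_mulmx mulrCA dvdp_mulIl.
Qed.

Lemma rank_Vandermonde (F : fieldType) (n k : nat) (u : 'rV[F]_k) :
  (k <= n)%N -> injective (u 0) -> \rank (Vandermonde n u) = k.
Proof.
move=> kn inj_u; apply/eqP; rewrite eqn_leq rank_leq_col.
have Vk : \rank (Vandermonde k u) = k.
  apply: mxrank_unit; rewrite unitmxE det_Vandermonde unitfE.
  apply/prodf_neq0 => i _; apply/prodf_neq0 => j ij.
  rewrite subr_eq0; apply: contraTneq ij => /inj_u ->.
  by rewrite ltnn.
rewrite -{1}Vk mxrankS //.
suff -> : Vandermonde k u = rowsub (widen_ord kn) (Vandermonde n u).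
  by rewrite rowsubE submxMl.
by apply/matrixP => i j; rewrite !mxE.
Qed.

(** The bound [m] on the degrees of the entries is corrected by the weight [i] of
    the row minus the weight [k] of the column; in a term of the Leibniz formula
    the weights of the rows and of the columns cancel. *)
Lemma size_det_leq (F : fieldType) (n m : nat) (M : 'M[{poly F}]_n) :
  (forall i k, M i k != 0%R -> size (M i k) + k <= (m + i).+1)%N ->
  (size (\det M) <= (m * n).+1)%N.
Proof.
move=> sM; rewrite /determinant; apply: leq_trans (size_sum _ _ _) _.
apply/bigmax_leqP => s _.
have [i0|] := boolP [exists i, M i (s i) == 0].
  case/existsP: i0 => i /eqP Mi0.
  by rewrite (bigD1 i) //= Mi0 mul0r mulr0 size_poly0.
rewrite negb_exists => /forallP nz.
rewrite size_Msign size_prod // cardT size_enum_ord leq_subLR addnS ltnS.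
have sum_s : (\sum_i s i = \sum_(i < n) i)%N.
  by rewrite [RHS](reindex_inj (@perm_inj _ s)).
rewrite -(leq_add2r (\sum_i s i)%N) -big_split /= sum_s.
apply: (@leq_trans (\sum_(i < n) (m.+1 + i))).
  by apply: leq_sum => i _; rewrite addSn sM.
by rewrite big_split /= sum_nat_const card_ord mulnS [(n * m)%N]mulnC.
Qed.

(** * Total degree and top form of bivariate polynomials *)

Section TotalDegree.

Variable F : fieldType.
Implicit Types A B C P Q : {poly {poly F}}.

Local Notation "p ^ f" := (map_poly f p) : ring_scope.

(** The inner variable is [x] and the outer one [u].  [homog A] is [A] after the
    substitution [u := t x], as a polynomial in [x] over [F[t]].  As a substitution
    it is multiplicative; its degree in [x] is the total degree of [A], and its
    leading coefficient is the dehomogenized form of highest degree of [A], so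
    that total degrees and top forms obey the one-variable rules for degrees and
    leading coefficients. *)
Definition homog A : {poly {poly F}} :=
  (map_poly (map_poly polyC) A).['X%:P * 'X].

Lemma homogD A B : homog (A + B) = homog A + homog B.
Proof. by rewrite /homog rmorphD hornerD. Qed.

Lemma homogN A : homog (- A) = - homog A.
Proof. by rewrite /homog rmorphN hornerN. Qed.

Lemma homogM A B : homog (A * B) = homog A * homog B.
Proof. by rewrite /homog rmorphM hornerM. Qed.

Lemma homogX : homog 'X = 'X%:P * 'X.
Proof. by rewrite /homog map_polyX hornerX. Qed.

Lemma coef_homog A m i :
  (homog A)`_m`_i = if (i <= m)%N then A`_i`_(m - i) else 0.
Proof.
have -> : homog A = \sum_(k < size A) (A`_k ^ polyC * ('X^k)%:P) * 'X^k.
  rewrite /homog (horner_coef_wide _ (size_poly _ _)); apply: eq_bigr => k _.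
  by rewrite coef_map_id0 ?map_poly0 // exprMn mulrA rmorphXn.
have coefk k : ((A`_k ^ polyC * ('X^k)%:P) * 'X^k)`_m`_i =
    if (k <= m)%N && (i == k) then A`_k`_(m - k) else 0.
  rewrite coefMXn ltnNge; case: leqP => km; rewrite ?coef0 //=.
  by rewrite coefMC coef_map coefCM coefXn; case: eqP; rewrite ?mulr1 ?mulr0.
rewrite !coef_sum; under eq_bigr do rewrite coefk.
have [iA|iA] := ltnP i (size A); last first.
  rewrite big1 => [|k _]; first by rewrite (nth_default 0 iA) coef0 if_same.
  by case: eqP => [ik|]; rewrite ?andbF //; move: iA; rewrite ik leqNgt ltn_ord.
rewrite (bigD1 (Ordinal iA)) //= eqxx andbT big1 ?addr0 // => k.
by rewrite -val_eqE /= eq_sym => /negbTE ->; rewrite andbF.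
Qed.

Lemma coef_homogD A i j : (homog A)`_(i + j)`_i = A`_i`_j.
Proof. by rewrite coef_homog leq_addr addKn. Qed.

Lemma homog_eq0 A : (homog A == 0) = (A == 0).
Proof.
apply/eqP/eqP => [A0|->]; last by rewrite /homog map_poly0 horner0.
by apply/polyP => i; apply/polyP => j; rewrite -coef_homogD A0 !coef0.
Qed.

Lemma coef_gt_tdeg A D i j :
  (size (homog A) <= D)%N -> (D <= i + j)%N -> A`_i`_j = 0.
Proof.
by move=> sA Dij; rewrite -coef_homogD (nth_default 0 (leq_trans sA Dij)) coef0.
Qed.

(** The variable [t] only comes from [u], so the top form has degree at most the
    degree in [u]. *)
Lemma size_top_form A : (size (lead_coef (homog A)) <= size A)%N.
Proof.
apply/leq_sizeP => i Ai; rewrite lead_coefE coef_homog.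
by rewrite (nth_default _ Ai) coef0; case: ifP.
Qed.

Lemma tdegXnM A i : (size (homog ('X^i * A)) <= size (homog A) + i)%N.
Proof.
have homogXn : homog 'X^i = ('X^i)%:P * 'X^i.
  by rewrite /homog map_polyXn hornerXn exprMn rmorphXn.
rewrite homogM homogXn mulrAC; apply: leq_trans (size_polyMleq _ _) _.
rewrite size_polyXn addnS /= leq_add2r.
by rewrite mul_polyC size_scale_leq.
Qed.

Section Monic.

Variables (Q : {poly {poly F}}) (n : nat).
Hypotheses (monQ : Q \is monic) (sQ : size Q = n.+1).
Hypothesis tQ : (size (homog Q) <= n.+1)%N.

Lemma monic_top_coef : (homog Q)`_n`_n = 1.
Proof.
rewrite -{1}[n]addn0 coef_homogD.
by move/monicP: monQ; rewrite lead_coefE sQ /= => ->; rewrite coef1.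
Qed.

Lemma size_homog_monic : size (homog Q) = n.+1.
Proof.
apply/eqP; rewrite eqn_leq tQ ltnNge; apply/negP => /leq_sizeP/(_ n (leqnn n)).
by move/polyP/(_ n)/eqP; rewrite monic_top_coef coef0 oner_eq0.
Qed.

Lemma size_top_monic : (n < size (lead_coef (homog Q)))%N.
Proof.
rewrite lead_coefE size_homog_monic /= ltnNge; apply/negP => /leq_sizeP/(_ n (leqnn n)).
by move/eqP; rewrite monic_top_coef oner_eq0.
Qed.

(** Division by a polynomial of total degree [n] that is monic of degree [n] in
    [u] does not raise the total degree: otherwise the top form of the remainder
    would cancel against a multiple of the top form of [Q], which has degree [n]
    in [t], whereas the remainder has degree less than [n] in [u]. *)
Lemma tdeg_rmodp C D :
  (size (homog C) <= D)%N -> (size (homog (Pdiv.Ring.rmodp C Q)) <= D)%N.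
Proof.
move=> sC; set R := Pdiv.Ring.rmodp C Q; rewrite leqNgt; apply/negP => DR.
have RE : homog (Pdiv.Ring.rdivp C Q) * homog Q = homog C - homog R.
  by rewrite {2}(Pdiv.RingMonic.rdivp_eq monQ C) homogD homogM addrK.
have Q0 : Q != 0 := monic_neq0 monQ.
have R0 : R != 0.
  by apply: contraTneq DR => ->; rewrite /homog map_poly0 horner0 size_poly0.
have := congr1 lead_coef RE.
rewrite lead_coefDr ?size_polyN ?(leq_ltn_trans sC) // lead_coefN lead_coefM.
move/(congr1 (fun p : {poly F} => size p)); rewrite size_polyN => sRE.
have : (size (lead_coef (homog R)) <= n)%N.
  by apply: leq_trans (size_top_form R) _; rewrite -ltnS -sQ Pdiv.Ring.ltn_rmodpN0.
rewrite leqNgt -sRE => /negP; apply.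
have lB0 : lead_coef (homog (Pdiv.Ring.rdivp C Q)) != 0.
  apply/negP => /eqP lB0; move: sRE; rewrite lB0 mul0r size_poly0 => /esym/eqP.
  by rewrite size_poly_eq0 lead_coef_eq0 homog_eq0 (negbTE R0).
rewrite size_mul // ?lead_coef_eq0 ?homog_eq0 //.
move: lB0; rewrite -size_poly_gt0; case: (size _) => // k _.
by rewrite addSn /= (leq_trans size_top_monic) ?leq_addl.
Qed.

End Monic.
End TotalDegree.

(** * Bezout's theorem *)

Section Bezout.

Variables (F : finFieldType) (P Q : {poly {poly F}}) (m n : nat).
Hypotheses (monQ : Q \is monic) (sQ : size Q = n.+1).
Hypotheses (tP : (size (homog P) <= m.+1)%N) (tQ : (size (homog Q) <= n.+1)%N).
(** Coprimality over [F(x)], in the form used below: [P] is not a zero divisor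
    modulo [Q]. *)
Hypothesis regP : forall A B, A * P = B * Q -> (size A <= n)%N -> A = 0.

Let rem i := Pdiv.Ring.rmodp ('X^i * P) Q.
(** The matrix of the multiplication by [P] on [F[x][u] / (Q)], in the basis of
    the powers of [u]; its determinant is the resultant of [P] and [Q]. *)
Let M : 'M[{poly F}]_n := \matrix_(i, k) (rem i)`_k.

Let size_rem i : (size (rem i) <= n)%N.
Proof. by rewrite -ltnS -sQ Pdiv.Ring.ltn_rmodpN0 ?monic_neq0. Qed.

Let det_neq0 : \det M != 0.
Proof.
apply/det0P => -[v v0 vM0]; move/eqP: v0; apply.
pose A := rVpoly v.
have remA : Pdiv.Ring.rmodp (A * P) Q = \sum_(i < n) v 0 i *: rem i.
  rewrite /A /rVpoly poly_def mulr_suml Pdiv.RingMonic.rmodp_sum //.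
  apply: eq_bigr => i _.
  by rewrite valK -scalerAl Pdiv.RingMonic.rmodpZ.
have : Pdiv.Ring.rmodp (A * P) Q = 0.
  apply/polyP => k; rewrite remA coef0 coef_sum; have [kn|nk] := ltnP k n.
    have /rowP/(_ (Ordinal kn)) := vM0; rewrite !mxE => vMk; rewrite -[RHS]vMk.
    by apply: eq_bigr => i _; rewrite coefZ mxE.
  by apply: big1 => i _; rewrite coefZ nth_default ?mulr0 // (leq_trans (size_rem i)).
move=> rA; have AP := Pdiv.RingMonic.rdivp_eq monQ (A * P).
rewrite rA addr0 in AP.
by rewrite -[v]rVpolyK -/A (regP AP (size_poly _ _)) linear0.
Qed.

Let size_det : (size (\det M) <= (m * n).+1)%N.
Proof.
apply: size_det_leq => i k; rewrite mxE => nz.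
have tR : (size (homog (rem i)) <= (m + i).+1)%N.
  apply: (tdeg_rmodp monQ sQ tQ); apply: leq_trans (tdegXnM _ _) _.
  by rewrite -addSn leq_add2r.
rewrite (polySpred nz) addSn ltnS.
rewrite leqNgt (addnC _.-1); apply: contraNN nz => lt_mi.
by rewrite -lead_coef_eq0 lead_coefE (coef_gt_tdeg tR lt_mi).
Qed.

Definition common_zeros : {set F * F} :=
  [set xu : F * F | (P.[xu.2%:P].[xu.1] == 0) && (Q.[xu.2%:P].[xu.1] == 0)].

(** At a common zero [(x, u)] the vector of the powers of [u] is in the kernel of
    the value of [M] at [x]; the vectors of distinct [u] are independent. *)
Let zeros_above (x : F) :
  (#|[set u : F | (x, u) \in common_zeros]| <= n - \rank (map_mx (horner_eval x) M))%N.
Proof.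
set E := [set u | _]; pose Qx := map_poly (horner_eval x) Q.
have QxE u : Qx.[u] = Q.[u%:P].[x].
  rewrite /Qx -[u in LHS](hornerC u x) -/(horner_eval x _) horner_map //.
have kn : (#|E| <= n)%N.
  have monQx : Qx \is monic by apply: monic_map.
  have sQx : size Qx = n.+1.
    by rewrite size_map_poly_id0 ?sQ // (monicP monQ) rmorph1 oner_eq0.
  rewrite -ltnS -sQx cardE max_poly_roots ?enum_uniq ?monic_neq0 //.
  apply/allP => u; rewrite mem_enum !inE /= => /andP[_ Qu].
  by rewrite rootE QxE.
pose u : 'rV[F]_#|E| := \row_j enum_val j.
have inj_u : injective (u 0) by move=> i j; rewrite !mxE => /enum_val_inj.
rewrite leq_subRL ?rank_leq_row // -{1}(rank_Vandermonde kn inj_u).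
apply: mulmx0_rank_max; apply/matrixP => i j; rewrite mxE mxE.
have := enum_valP j; rewrite !inE /= => /andP[/eqP Pu /eqP Qu].
transitivity ((rem i).[(enum_val j)%:P].[x]).
  rewrite (horner_coef_wide _ (size_rem i)) horner_sum; apply: eq_bigr => k _.
  by rewrite !mxE hornerM /horner_eval -rmorphXn hornerC.
have := Pdiv.RingMonic.rdivp_eq monQ ('X^i * P).
move/(congr1 (fun p => p.[(enum_val j)%:P].[x])).
by rewrite hornerD hornerD !hornerM Pu Qu !mulr0 add0r => <-.
Qed.

(** The zeros above [x] are at most as many as the order of vanishing at [x] of
    [\det M], a nonzero polynomial of degree at most [m * n]. *)
Theorem bezout : (#|common_zeros| <= m * n)%N.
Proof.
have -> : #|common_zeros| = (\sum_(x : F) #|[set u : F | (x, u) \in common_zeros]|)%N.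
  rewrite -sum1_card.
  rewrite (eq_bigl (fun xu : F * F => true && ((xu.1, xu.2) \in common_zeros)));
    last by case.
  rewrite -(pair_big_dep xpredT (fun x u => (x, u) \in common_zeros) (fun _ _ => 1%N)) /=.
  by apply: eq_bigr => x _; rewrite -sum1_card; apply: eq_bigl => u; rewrite inE.
apply: (leq_trans (leq_sum _ (fun x _ => zeros_above x))).
rewrite -ltnS; apply: leq_trans size_det.
rewrite -[X in (_ < X)%N]prednK ?size_poly_gt0 // ltnS -big_enum /=.
by apply: sum_root_order_leq; rewrite ?det_neq0 ?enum_uniq // => x _; apply: dvdp_det_corank.
Qed.

End Bezout.

(** * Common components *)

(** The hypothesis says that a common factor of [P] and [Q] over [F(x)] has degree
    at most one in [u].  If the factor [H] has degree one, then [A = Q / H] up to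
    a scalar of [F(x)], and the claim is that [H] may be taken to be [u - r] with
    [r] in [F[x]].  This is Gauss' lemma, by descent on the degree of the leading
    coefficient of [A]. *)
Lemma common_poly_root (F : fieldType) (P Q : {poly {poly F}}) (n : nat) :
    Q \is monic -> size Q = n.+1 ->
    (forall A B, A * P = B * Q -> A != 0 -> (n <= size A)%N) ->
  forall A B, A * P = B * Q -> A != 0 -> (size A <= n)%N ->
  exists r : {poly F}, P.[r] = 0 /\ Q.[r] = 0.
Proof.
move=> monQ sQ minA A B.
have [k] := ubnP (size (lead_coef A)); elim: k A B => // k IHk A B.
rewrite ltnS => ltk AB A0 sA.
have Q0 := monic_neq0 monQ.
have sAn : size A = n by apply/eqP; rewrite eqn_leq sA (minA _ _ AB A0).
have n0 : (0 < n)%N by rewrite -sAn size_poly_gt0.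
have lA0 : lead_coef A != 0 by rewrite lead_coef_eq0.
(* Reduce [u A] modulo [Q], then lower the degree of its coefficient of
   [u ^ (n - 1)] below that of the leading coefficient of [A].  A nonzero result
   is a better [A]; a zero result says that [u - q] times [A] is [Q] times an
   element of [F[x]]. *)
pose A1 := 'X * A - (lead_coef A)%:P * Q.
pose q := A1`_n.-1 %/ lead_coef A.
pose A2 := A1 - q%:P * A; pose B2 := ('X - q%:P) * B - (lead_coef A)%:P * P.
have A2E : A2 = ('X - q%:P) * A - (lead_coef A)%:P * Q by rewrite /A2 /A1; ring.
have AB2 : A2 * P = B2 * Q.
  by rewrite A2E /B2 !mulrBl -!mulrA AB [P * Q]mulrC.
have [A2_0|A2_neq0] := eqVneq A2 0.
  exists q; split.
    have : B2 * Q = 0 by rewrite -AB2 A2_0 mul0r.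
    move/eqP; rewrite mulf_eq0 (negbTE Q0) orbF /B2 => /eqP/(congr1 (horner^~ q)).
    rewrite !(hornerD, hornerN, hornerM, hornerX, hornerC) subrr mul0r sub0r.
    by move/eqP; rewrite oppr_eq0 mulf_eq0 (negbTE lA0) => /eqP.
  move/(congr1 (horner^~ q)): A2_0; rewrite A2E.
  rewrite !(hornerD, hornerN, hornerM, hornerX, hornerC) subrr mul0r sub0r.
  by move/eqP; rewrite oppr_eq0 mulf_eq0 (negbTE lA0) => /eqP.
have sA1 : (size A1 <= n)%N.
  apply/leq_sizeP => j; rewrite leq_eqVlt => /predU1P[<-|nj].
    rewrite coefB mulrC coefMX coefCM -{3}[n]/(n.+1.-1) -sQ -lead_coefE (monicP monQ).
    by rewrite gtn_eqF // -{1}sAn -lead_coefE mulr1 subrr.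
  rewrite nth_default //; apply: leq_trans (size_polyD _ _) _.
  rewrite size_polyN geq_max mulrC size_mulX // sAn nj.
  by rewrite mul_polyC (leq_trans (size_scale_leq _ _)) // sQ.
have sA2 : (size A2 <= n)%N.
  apply: leq_trans (size_polyD _ _) _; rewrite geq_max sA1 size_polyN.
  by rewrite mul_polyC (leq_trans (size_scale_leq _ _)).
apply: (IHk _ _ _ AB2 A2_neq0 sA2); apply: leq_trans ltk.
have -> : lead_coef A2 = A1`_n.-1 %% lead_coef A.
  have sA2n : size A2 = n by apply/eqP; rewrite eqn_leq sA2 (minA _ _ AB2 A2_neq0).
  rewrite lead_coefE sA2n coefB coefCM -{2}sAn -lead_coefE.
  by rewrite {1}(divp_eq A1`_n.-1 (lead_coef A)) addrAC subrr add0r.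
by rewrite ltn_modp.
Qed.

(** With [d] the degree of [f] and [c] its leading coefficient, the terms of
    degree [d] cancel and the coefficient of degree [d - 1] is [c * a * d]. *)
Lemma size_shift_sub (F : fieldType) (f : {poly F}) (a : F) :
  a != 0 -> (size f).-1%:R != 0 :> F ->
  size (f \Po ('X + a%:P) - f) = (size f).-1.
Proof.
set d := (size f).-1 => a0 d0.
have dgt0 : (0 < d)%N by case: d d0; rewrite ?eqxx.
have sf : size f = d.+1 by rewrite /d in dgt0 *; case: (size f) dgt0.
have sfa : size (f \Po ('X + a%:P)) = d.+1 by rewrite size_comp_poly2 ?size_XaddC.
have lfa : lead_coef (f \Po ('X + a%:P)) = lead_coef f.
  by rewrite lead_coef_comp ?size_XaddC // lead_coefXaddC expr1n mulr1.
apply/eqP; rewrite eqn_leq; apply/andP; split.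
  apply/leq_sizeP => j; rewrite coefB leq_eqVlt => /predU1P[<-|dj].
    by move: lfa; rewrite !lead_coefE sfa sf /= => ->; rewrite subrr.
  by rewrite !nth_default ?subrr ?sfa ?sf.
have : (f \Po ('X + a%:P) - f)`_d.-1 != 0.
  have coefXa i : (('X + a%:P) ^+ i)`_d.-1 =
      if (d.-1 <= i)%N then a ^+ (i - d.-1) *+ 'C(i, d.-1) else 0.
    have [di|di] := leqP d.-1 i; last first.
      by rewrite nth_default // -[a]opprK polyCN size_exp_XsubC.
    rewrite addrC exprDn coef_sum (bigD1 (Ordinal (di : (d.-1 < i.+1)%N))) //=.
    rewrite -rmorphXn coefMn coefCM coefXn eqxx mulr1 big1 ?addr0 // => j.
    rewrite -val_eqE eq_sym /= -rmorphXn coefMn coefCM coefXn => /negbTE ->.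
    by rewrite mulr0 mul0rn.
  rewrite coefB coef_comp_poly sf -(prednK dgt0) !big_ord_recr /= big1 => [|i _].
    rewrite !coefXa !leqnn leqnSn subnn subSnn expr1 expr0 binn mulr1n mulr1 add0r.
    rewrite addrAC subrr add0r binSn prednK // -mulr_natr.
    rewrite !mulf_neq0 // -[d]/(d.+1.-1) -sf -lead_coefE lead_coef_eq0.
    by rewrite -size_poly_eq0 sf.
  by rewrite coefXa leqNgt ltn_ord mulr0.
by apply: contraR; rewrite -ltnNge => ?; rewrite nth_default // -ltnS prednK.
Qed.

(** In [phi(u) - psi(x)] only the two leading terms reach the total degree. *)
Lemma homog_sepvar (F : fieldType) (phi psi : {poly F}) D :
    size phi = D.+2 -> size psi = D.+2 -> lead_coef phi = lead_coef psi ->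
    let H := homog (phi^:P - psi%:P) in
  size H = D.+2 /\ lead_coef H = lead_coef phi *: ('X^(D.+1) - 1).
Proof.
move=> s1 s2 lE H.
have coefi i j : (phi^:P - psi%:P)`_i`_j =
    (if j == 0%N then phi`_i else 0) - (if i == 0%N then psi`_j else 0).
  have -> : (phi^:P - psi%:P)`_i = (phi`_i)%:P - (if i == 0%N then psi else 0).
    by rewrite coefB coef_map coefC.
  rewrite coefB coefC.
  by case: (i == 0%N); rewrite ?coef0.
have HE m : (D < m)%N -> H`_m = phi`_m *: 'X^m - (psi`_m)%:P.
  move=> Dm; have m0 : (m == 0%N) = false by rewrite gtn_eqF ?(leq_ltn_trans _ Dm).
  apply/polyP => i; rewrite [RHS]coefB coefZ coefXn coefC coef_homog.
  case: (ltngtP i m) => [im|mi|->]; last by rewrite coefi subnn eqxx m0 mulr1.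
    rewrite coefi gtn_eqF ?subn_gt0 // mulr0.
    by case: eqP => [->|_]; rewrite ?subn0.
  by rewrite mulr0 gtn_eqF ?subr0 // (leq_ltn_trans _ mi).
have HD : H`_D.+1 = lead_coef phi *: ('X^(D.+1) - 1).
  rewrite HE // scalerBr; move: lE; rewrite !lead_coefE s1 s2 /= => ->.
  by rewrite alg_polyC.
have sH : size H = D.+2.
  apply/eqP; rewrite eqn_leq; apply/andP; split.
    apply/leq_sizeP => j Dj; rewrite HE ?(ltnW Dj) //.
    by rewrite !nth_default ?s1 ?s2 // scale0r subrr.
  rewrite ltnNge; apply/negP => /leq_sizeP/(_ _ (leqnn _))/eqP; rewrite HD.
  rewrite scaler_eq0 lead_coef_eq0 -size_poly_eq0 s1 /= -size_poly_eq0.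
  by rewrite size_XnsubC.
by rewrite lead_coefE sH.
Qed.

(** Modulo [t ^ (d + 1) - 1] one has [t ^ (d + 2) - 1 = t - 1], so
    [t ^ (d + 1) - 1] divides [p * (t - 1) ^ 2]. *)
Lemma top_form_obstruction (F : fieldType) (p : {poly F}) d :
  p != 0 -> 'X^(d.+1) - 1 %| p * ('X - 1) * ('X^(d.+2) - 1) -> (d <= size p)%N.
Proof.
have -> : 'X^(d.+2) - 1 = 'X * ('X^(d.+1) - 1) + ('X - 1) :> {poly F}.
  by rewrite [in LHS]exprS; ring.
move=> p0; rewrite mulrDr dvdp_addr; last by rewrite mulrA dvdp_mull.
have X1 : 'X - 1 != 0 :> {poly F} by rewrite polyXsubC_eq0.
have nz : p * ('X - 1) * ('X - 1) != 0 by rewrite !mulf_neq0.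
move/(dvdp_leq nz); rewrite size_XnsubC // !size_mul ?mulf_neq0 // !size_XsubC.
by rewrite !addn2.
Qed.

(** Both [d] and [#|K|] would vanish in [K], hence so would their gcd. *)
Lemma natr_coprime_card_neq0 (K : finNzRingType) (d : nat) :
  coprime d #|K| -> d%:R != 0 :> K.
Proof.
have K0 : #|K|%:R = 0 :> K.
  by rewrite -cardsT; exact: (@expg_cardG _ [set: K]%G (1%R : K) (in_setT _)).
move=> cop; apply/eqP => d0.
have Kgt0 : (0 < #|K|)%N by apply/card_gt0P; exists 0.
have [u v uv _] := egcdnP d Kgt0.
have := congr1 (fun k => k%:R : K) uv.
rewrite gcdnC (eqP cop) natrD !natrM d0 K0 !mulr0 add0r => /esym/eqP.
by rewrite oner_eq0.
Qed.

(** * The two curves *)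

Section Curves.

Variables (F : fieldType) (f g : {poly F}) (b : F) (n : nat).
Hypotheses (sf : size f = n.+3) (sg : size g = n.+2) (monG : g \is monic).
Variable Q : {poly {poly F}}.
Let P : {poly {poly F}} := f^:P - (f + b%:P)%:P.
Hypothesis QG : Q * ('X - 'X%:P) = g^:P - g%:P.

Lemma tdegP :
  size (homog P) = n.+3 /\
  lead_coef (homog P) = lead_coef f *: ('X^(n.+2) - 1).
Proof.
apply: homog_sepvar => //; rewrite ?size_polyDl ?lead_coefDl // ?sf //;
  by rewrite (leq_ltn_trans (size_polyC_leq1 _)).
Qed.

Lemma monicQ_size : Q \is monic /\ size Q = n.+1.
Proof.
have sG : size (g^:P - g%:P) = n.+2.
  rewrite size_polyDl size_map_polyC // size_polyN sg.
  by rewrite (leq_ltn_trans (size_polyC_leq1 _)).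
have mG : g^:P - g%:P \is monic.
  rewrite monicE lead_coefDl; last first.
    by rewrite size_map_polyC size_polyN sg (leq_ltn_trans (size_polyC_leq1 _)).
  by rewrite -monicE monic_map.
have mQ : Q \is monic by rewrite -(monicMr _ (monicXsubC 'X)) QG.
split=> //; move: sG; rewrite -QG size_Mmonic ?monicXsubC ?monic_neq0 // size_XsubC addn2.
by case.
Qed.

Lemma homog_diag : homog ('X - 'X%:P : {poly {poly F}}) = ('X - 1)%:P * 'X.
Proof.
rewrite homogD homogN homogX /homog map_polyC hornerC /=  map_polyX.
by rewrite rmorphB mulrBl mul1r.
Qed.

Lemma tdegQ : size (homog Q) = n.+1.
Proof.
have [] := homog_sepvar sg sg erefl; rewrite -QG homogM homog_diag => + _.
rewrite mulrA size_mulX; last first.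
  by rewrite !mulf_neq0 ?polyC_eq0 ?polyXsubC_eq0 ?homog_eq0 ?monic_neq0 ?monicQ_size.1.
by rewrite mulrC mul_polyC size_scale ?polyXsubC_eq0 //; case.
Qed.

(** In other words, a common factor has degree at most one in [u].  In terms of top forms: the
    gcd of [t ^ (n + 2) - 1] and [t ^ (n + 1) - 1] is [t - 1]. *)
Lemma cofactor_size_geq A B : A * P = B * Q -> A != 0 -> (n <= size A)%N.
Proof.
move=> AB A0; apply: leq_trans (size_top_form A).
apply: top_form_obstruction; first by rewrite lead_coef_eq0 homog_eq0.
have := congr1 (fun C => lead_coef (homog (C * ('X - 'X%:P)))) AB.
rewrite -[B * Q * _]mulrA QG !homogM !lead_coefM (homog_sepvar sg sg erefl).2 tdegP.2.
rewrite homog_diag lead_coefMX lead_coefC (monicP monG) scale1r.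
set p := lead_coef _; set q := lead_coef (homog B) => E.
have f0 : lead_coef f != 0 by rewrite lead_coef_eq0 -size_poly_eq0 sf.
rewrite mulrAC -(dvdpZr _ _ f0) scalerAl scalerAr E.
by rewrite dvdp_mulIr.
Qed.

Hypothesis n1F : n.+2%:R != 0 :> F.
Hypothesis b0 : b != 0.

(** If [f(r(x)) = f(x) + b] and [g(r(x)) = g(x)], comparing degrees and leading
    coefficients gives [r = x + e]; then [f(x + e) - f(x) = b] is constant, which
    forces [e = 0] and [b = 0]. *)
Lemma no_common_poly_root (r : {poly F}) : P.[r] = 0 -> Q.[r] = 0 -> False.
Proof.
rewrite hornerD hornerN hornerC => Pr Qr.
have fr : f \Po r = f + b%:P by apply/eqP; rewrite -subr_eq0; apply/eqP.
have gr : g \Po r = g.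
  apply/eqP; rewrite -subr_eq0; apply/eqP.
  by rewrite /comp_poly -[X in _ - X](hornerC g r) -hornerN -hornerD -QG hornerM Qr mul0r.
have sr : size r = 2.
  have := size_comp_poly g r; rewrite gr sg /= -{1}[n.+1]muln1 => /eqP.
  by rewrite eqn_pmul2l //; case: (size r) => [|[|[]]].
have lg : lead_coef r ^+ n.+1 = 1.
  have := lead_coef_comp g (_ : 1 < size r)%N; rewrite sr gr sg (monicP monG) mul1r /=.
  by move/(_ isT) => <-.
have lr : lead_coef r = 1.
  have := lead_coef_comp f (_ : 1 < size r)%N; rewrite sr fr sf => /(_ isT).
  rewrite lead_coefDl ?sf ?(leq_ltn_trans (size_polyC_leq1 _)) //= exprS lg mulr1.
  rewrite -[LHS]mulr1 => /mulfI -> //.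
  by rewrite lead_coef_eq0 -size_poly_eq0 sf.
have rE : r = 'X + (r`_0)%:P.
  apply/polyP => -[|[|i]]; rewrite coefD coefX coefC /= ?add0r ?addr0 //.
    by rewrite -lr lead_coefE sr.
  by rewrite nth_default ?sr.
have [e0|e0] := eqVneq r`_0 0.
  move: fr; rewrite rE e0 addr0 comp_polyXr => /eqP.
  by rewrite addrC -subr_eq subrr eq_sym polyC_eq0 (negbTE b0).
have := size_shift_sub e0 (_ : (size f).-1%:R != 0); rewrite sf => /(_ n1F).
rewrite -rE fr addrC addKr => sb.
by have := size_polyC_leq1 b; rewrite sb.
Qed.

Lemma coprime_curves A B : A * P = B * Q -> (size A <= n)%N -> A = 0.
Proof.
move=> AB sA; apply/eqP; apply: contraT => A0.
have [mQ sQ] := monicQ_size.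
by have [r [/no_common_poly_root]] :=
  common_poly_root mQ sQ cofactor_size_geq AB A0 sA.
Qed.

End Curves.

(* The case d = 1 is excluded: there the left side is #|K| while
   d * (d - 2) = -1.  For d >= 2 the truncated d - 2 is exact. *)
Theorem theorem12 (K : finFieldType) (f : {poly K}) (d : nat) (a b : K)
    (hdeg : d = (size f).-1) (hd : (0 < d)%N) (hd1 : d <> 1%N)
    (hgcd : gcdn d #|K| = 1%N) (ha : a != 0) (hb : b != 0) :
  (cBCT 1%R (fun x => f.[x]) a b <= d * (d - 2))%N.
Proof.
have d0 : d%:R != 0 :> K by apply: natr_coprime_card_neq0; apply/eqP.
case: d => [|[|n]] // in hdeg hd hd1 hgcd d0 *; rewrite subSS subn1 /=.
have sf : size f = n.+3 by case: (size f) hdeg => // k /= ->.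
(* Dividing by the leading coefficient makes the second curve monic in [u]. *)
pose g0 := f \Po ('X + a%:P) - f.
have sg0 : size g0 = n.+2 by rewrite size_shift_sub // -hdeg.
have lg0 : lead_coef g0 != 0 by rewrite lead_coef_eq0 -size_poly_eq0 sg0.
pose g := (lead_coef g0)^-1 *: g0.
have sg : size g = n.+2 by rewrite size_scale ?invr_eq0.
have mg : g \is monic by rewrite monicE lead_coefZ mulVf.
have gE x u : g.[u] - g.[x] =
    (lead_coef g0)^-1 * ((f.[u + a] - f.[x + a]) - (f.[u] - f.[x])).
  rewrite /g !hornerZ /g0 !(hornerD, hornerN, horner_comp, hornerX, hornerC); ring.
have [Q /esym QG] : exists Q, g^:P - g%:P = Q * ('X - 'X%:P).
  apply/factor_theorem; rewrite rootE hornerD hornerN hornerC.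
  by rewrite -/(g \Po 'X) comp_polyXr subrr.
have [mQ sQ] := monicQ_size sg mg QG.
have [tP _] := tdegP b sf.
have tQ := tdegQ sg mg QG.
have reg := coprime_curves sf sg mg QG d0 hb.
apply: leq_trans (bezout mQ sQ (eq_leq tP) (eq_leq tQ) reg).
(* The pair [(x, y)] of the table corresponds to the point [(x, u)], [u = x + y]. *)
rewrite /cBCT -(card_imset _ (can_inj (f := fun xy => (xy.1, xy.1 + xy.2))
  (g := fun xu : K * K => (xu.1, xu.2 - xu.1)) _)); last first.
  by case=> x y /=; rewrite addrC addKr.
apply/subset_leq_card/subsetP => _ /imsetP[[x y] + ->].
rewrite !inE /= !mul1r => /andP[/eqP E1 /eqP E2].
set u := x + y in E1 E2 *.
have eval (p : {poly K}) : (p^:P).[u%:P] = p.[u]%:P.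
  by rewrite horner_map.
apply/andP; split.
  rewrite hornerD hornerN eval !(hornerC, hornerD, hornerN).
  by rewrite opprD addrA E1 subrr.
(* As [b] is nonzero, the points lie off the diagonal removed from [g(u) = g(x)]. *)
have ux : u - x != 0.
  by rewrite subr_eq0; apply: contraNneq hb => ux; rewrite -E1 ux subrr.
rewrite -(inj_eq (mulIf ux)) mul0r.
have -> : Q.[u%:P].[x] * (u - x) = (Q * ('X - 'X%:P)).[u%:P].[x].
  by rewrite !(hornerM, hornerD, hornerN, hornerX, hornerC).
by rewrite QG hornerD hornerN hornerC eval hornerD hornerN hornerC gE E1 E2 subrr mulr0.
Qed.
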